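(* Consider the band model without lower bounding functions, $\mathscr G_j=\{G_j:0\le g_j\le g_j^U\}$, $j\in\{0,1\}$, where $g_j^U=(1+\epsilon_j)f_j$ with nominal densities $f_j$ and $\epsilon_j>0$. Let $l=g_1^U/g_0^U$ and let $(\hat G_0,\hat G_1)$ be the least favorable distributions, with densities $$\hat g_0=\begin{cases}g_0^U,& l\ge t_l,\\ \frac1{t_l}g_1^U,& l<t_l,\end{cases}\qquad \hat g_1=\begin{cases}g_1^U,& l\le t_u,\\ t_ug_0^U,& l>t_u,\end{cases}$$ where $0<t_l<t_u$ are such that $\int_\Omega\hat g_0\,d\mu=\int_\Omega\hat g_1\,d\mu=1$, and let $\hat l=\hat g_1/\hat g_0$. Then $(\hat G_0,\hat G_1)$ is single-sample minimax robust, i.e. $$G_0[\hat l<t]\ge\hat G_0[\hat l<t],\qquad G_1[\hat l<t]\le\hat G_1[\hat l<t]$$ for all $t\in\mathbb R_{\ge0}$ and all $(G_0,G_1)\in\mathscr G_0\times\mathscr G_1$.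
   Context: All densities are with respect to a measure $\mu$ on $\Omega$; $g_j$ is the density of the probability measure $G_j$, and $G_j[\hat l<t]=G_j(\{y\in\Omega:\hat l(y)<t\})$. Equivalently, $\mathscr G_j$ is the upper $\epsilon$-contamination model $\{G_j: G_j=(1+\epsilon_j)F_j-\epsilon_jH,\ H\text{ a probability measure}\}$ (with $G_j$ a probability measure). Standing assumption for band models: the bounding functions are chosen so that $\mathscr G_0\cap\mathscr G_1=\emptyset$. With these densities, $\hat l=t_l$ on $\{l<t_l\}$, $\hat l=l$ on $\{t_l\le l\le t_u\}$ and $\hat l=t_u$ on $\{l>t_u\}$. *)

(* Defs.v *)
From HB Require Import structures.
From mathcomp Require Import all_boot all_order all_algebra.
From mathcomp Require Import all_classical all_reals all_analysis.
From mathcomp Require Import measurable_realfun.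
Import Order.TTheory GRing.Theory Num.Theory.
Import numFieldNormedType.Exports.

Set Implicit Arguments.
Unset Strict Implicit.
Unset Printing Implicit Defensive.

Local Open Scope classical_set_scope.
Local Open Scope ring_scope.

Section Defs.
Context (d : measure_display) (T : measurableType d) (R : realType).
Variable mu : {measure set T -> \bar R}.

Definition has_density (G : set T -> \bar R) (g : T -> R) : Prop :=
  [/\ measurable_fun setT g, forall x, 0 <= g x &
      forall A, measurable A -> G A = (\int[mu]_(x in A) (g x)%:E)%E].

(* A density is only determined up to a mu-null set; asking the bound of some
   version everywhere is the same as asking it mu-almost everywhere. *)
Definition upper_band (gU : T -> R) : set (probability T R) :=
  [set G | exists2 g : T -> R, has_density G g & forall x, g x <= gU x].

Definition probability_density (f : T -> R) : Prop :=
  [/\ measurable_fun setT f, forall x, 0 <= f x &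
      (\int[mu]_x (f x)%:E = 1)%E].

Definition inflate (eps : R) (f : T -> R) (x : T) : R := (1 + eps) * f x.

(* The quotient p / q of nonnegative functions, with values in [0, +oo]:
   it is +oo where q = 0 < p, and the expression 0 / 0 is read as c x. *)
Definition likelihood_ratio (c : T -> \bar R) (p q : T -> R) (x : T) : \bar R :=
  if q x != 0 then (p x / q x)%:E else if p x != 0 then +oo%E else c x.

Definition lfd0 (gU0 gU1 : T -> R) (l : T -> \bar R) (tl : R) (x : T) : R :=
  if (tl%:E <= l x)%E then gU0 x else tl^-1 * gU1 x.

Definition lfd1 (gU0 gU1 : T -> R) (l : T -> \bar R) (tu : R) (x : T) : R :=
  if (l x <= tu%:E)%E then gU1 x else tu * gU0 x.

Definition clip (tl tu : R) (l : T -> \bar R) (x : T) : \bar R :=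
  if (l x < tl%:E)%E then tl%:E
  else if (l x <= tu%:E)%E then l x else tu%:E.

(* Both least favorable densities vanish where exactly one of gU0, gU1 does
   (l = 0 or l = +oo), and such points may be charged by members of the band.
   There 0 / 0 takes the value of l clipped to [tl, tu], so that the ratio is
   tl on {l < tl} and tu on {l > tu} throughout. *)
Definition lfd_ratio (gU0 gU1 : T -> R) (l : T -> \bar R) (tl tu : R) :
    T -> \bar R :=
  likelihood_ratio (clip tl tu l) (lfd1 gU0 gU1 l tu) (lfd0 gU0 gU1 l tl).

Definition single_sample_minimax_robust (P0 P1 : set (probability T R))
    (Q0 Q1 : probability T R) (lhat : T -> \bar R) : Prop :=
  forall t : R, 0 <= t ->
  forall G0 G1 : probability T R, P0 G0 -> P1 G1 ->
    (Q0 [set y | lhat y < t%:E] <= G0 [set y | lhat y < t%:E])%E /\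
    (G1 [set y | lhat y < t%:E] <= Q1 [set y | lhat y < t%:E])%E.

End Defs.

(* Main.v *)
Require Import Defs.
From HB Require Import structures.
From mathcomp Require Import all_boot all_order all_algebra.
From mathcomp Require Import all_classical all_reals all_analysis.
From mathcomp Require Import measurable_realfun.
Import Order.TTheory GRing.Theory Num.Theory.
Import numFieldNormedType.Exports.

Local Open Scope classical_set_scope.
Local Open Scope ring_scope.

(** The clipped ratio takes values in [tl, tu], so only thresholds t in
    (tl, tu] matter, and for these {lhat < t} = {l < t}. The density hatg1
    attains its upper bound gU1 on this set, while hatg0 attains gU0 on its
    complement: no member of the band can put more mass there. *)

(** The densities are compared on [A] only: a least favorable density reaches the band's upper bound
    on part of the space, not everywhere. *)
Lemma le_has_density (d : measure_display) (T : measurableType d)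
    (R : realType) (mu : {measure set T -> \bar R})
    (G H : set T -> \bar R) (g h : T -> R) (A : set T) :
  has_density mu G g -> has_density mu H h -> measurable A ->
  (forall x, A x -> g x <= h x) -> (G A <= H A)%E.
Proof.
move=> [mg g0 Gg] [mh h0 Hh] mA gh; rewrite Gg// Hh//.
apply: ge0_le_integral => //.
- by move=> x _; rewrite lee_fin.
- by apply/measurable_EFinP; exact: measurable_funTS.
- by apply/measurable_EFinP; exact: measurable_funTS.
Qed.

(** Clearing the denominator turns [p / q < t] into [p < t * q] where [q > 0]. Where [q = 0 < p] the
    ratio is [+oo] and contributes nothing; where both vanish, [c] decides. *)
Lemma measurable_likelihood_ratio_lt (d : measure_display)
    (T : measurableType d) (R : realType) (c : T -> \bar R) (p q : T -> R)
    (t : R) :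
  measurable_fun setT c -> measurable_fun setT p -> measurable_fun setT q ->
  (forall x, 0 <= q x) ->
  measurable [set x | (likelihood_ratio c p q x < t%:E)%E].
Proof.
move=> mc mp mq q0.
have -> : [set x | (likelihood_ratio c p q x < t%:E)%E] =
    ([set x | 0 < q x] `&` [set x | p x < t * q x]) `|`
    (([set x | q x = 0] `&` [set x | p x = 0]) `&` [set x | (c x < t%:E)%E]).
  apply/seteqP; split=> x /=; rewrite /likelihood_ratio.
  - case: eqP => [q_eq0 | /eqP q_neq0].
      by case: eqP => //= p_eq0 ct; right.
    have q_gt0 : 0 < q x by rewrite lt0r q_neq0 q0.
    by rewrite /= lte_fin ltr_pdivrMr// => ?; left.
  - move=> [[q_gt0 pt]|[[-> ->]]]; last by rewrite eqxx.
    by rewrite gt_eqF//= lte_fin ltr_pdivrMr.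
have mlt (f g : T -> R) : measurable_fun setT f -> measurable_fun setT g ->
    measurable [set x | f x < g x].
  by move=> mf mg; rewrite -[X in measurable X]setTI; exact: measurable_fun_ltr.
have meq0 (f : T -> R) : measurable_fun setT f -> measurable [set x | f x = 0].
  move=> mf; rewrite -[X in measurable X]setTI.
  exact: (mf measurableT [set 0] (measurable_set1 0)).
apply: measurableU; [|apply: measurableI].
- apply: measurableI; apply: mlt => //; exact: measurable_funM.
- by apply: measurableI; exact: meq0.
- rewrite -[X in measurable X]setTI; exact: emeasurable_fun_infty_o.
Qed.

(** The identity holds at every point, not just almost everywhere, because the value given to 0 / 0
    in [lfd_ratio] is [clip] itself. *)
Lemma lfd_ratioE (d : measure_display) (T : measurableType d)
    (R : realType) (gU0 gU1 : T -> R) (c : T -> \bar R) (tl tu : R) (x : T) :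
  0 < tl -> tl < tu -> 0 <= gU0 x -> 0 <= gU1 x ->
  let l := likelihood_ratio c gU1 gU0 in
  lfd_ratio gU0 gU1 l tl tu x = clip tl tu l x.
Proof.
move=> tl0 tltu u0 u1 l.
have tu0 : 0 < tu by exact: lt_trans tltu.
rewrite /lfd_ratio {1}/likelihood_ratio /lfd0 /lfd1.
(* If [gU0] or [gU1] vanishes at [x], then so do both least favorable densities, and the default
   value is read off. Only the fourth case has a genuine quotient. *)
have [u0E|u0N] := eqVneq (gU0 x) 0; have [u1E|u1N] := eqVneq (gU1 x) 0.
- by rewrite u0E u1E !mulr0 !if_same eqxx.
- have lE : l x = +oo%E by rewrite /l /likelihood_ratio u0E u1N eqxx.
  by rewrite lE leey /= u0E eqxx mulr0 eqxx.
- have lE : l x = 0%E by rewrite /l /likelihood_ratio u0N u1E mul0r.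
  by rewrite lE !lee_fin leNgt tl0 /= (ltW tu0) u1E mulr0 eqxx.
have lE : l x = (gU1 x / gU0 x)%:E by rewrite /l /likelihood_ratio u0N.
rewrite /clip lE !lee_fin !lte_fin.
have [lelt|ltl] := leP tl (gU1 x / gU0 x).
  by rewrite u0N; case: ifP => // _; rewrite mulfK.
(* Here [l < tl], so the quotient is [gU1] over [tl^-1 * gU1], that is [tl]. *)
rewrite (le_trans (ltW ltl) (ltW tltu)).
have hatg0_neq0 : tl^-1 * gU1 x != 0.
  by rewrite mulf_neq0 ?invr_neq0 ?(gt_eqF tl0).
by rewrite hatg0_neq0 invfM invrK mulrCA divff// mulr1.
Qed.

(** Values raised to [tl] stay below [t], which needs [tl < t] strictly; values lowered to [tu] stay
    at or above [t], for which [t = tu] is allowed. *)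
Lemma clip_lt (d : measure_display) (T : measurableType d)
    (R : realType) (tl tu t : R) (l : T -> \bar R) (x : T) :
  tl < t -> t <= tu ->
  (clip tl tu l x < t%:E)%E = (l x < t%:E)%E.
Proof.
move=> tlt ttu; rewrite /clip.
case: (ltP (l x) tl%:E) => [ltl|_].
  by rewrite lte_fin tlt (lt_trans ltl).
case: (leP (l x) tu%:E) => // tul.
by rewrite lte_fin ltNge ttu/= ltNge (le_trans _ (ltW tul))// lee_fin.
Qed.

Lemma clip_ge (d : measure_display) (T : measurableType d)
    (R : realType) (tl tu : R) (l : T -> \bar R) (x : T) :
  tl <= tu ->
  (tl%:E <= clip tl tu l x)%E.
Proof.
move=> tltu; rewrite /clip; case: (ltP (l x) tl%:E) => // ?.
by case: (leP (l x) tu%:E).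
Qed.

Lemma clip_le (d : measure_display) (T : measurableType d)
    (R : realType) (tl tu : R) (l : T -> \bar R) (x : T) :
  tl <= tu ->
  (clip tl tu l x <= tu%:E)%E.
Proof.
move=> tltu; rewrite /clip; case: (ltP (l x) tl%:E) => _ //.
by case: (leP (l x) tu%:E).
Qed.

(** Total mass one turns an upper bound on the complement into a lower bound on the set; this is how
    an upper band yields the inequality for [G0]. *)
Lemma probability_le_setC (d : measure_display) (T : measurableType d)
    (R : realType) (P Q : probability T R) (A : set T) :
  measurable A -> (P (~` A) <= Q (~` A))%E -> (Q A <= P A)%E.
Proof.
move=> mA PQ; rewrite -[A]setCK !(probability_setC _ (measurableC mA)).
by rewrite leeB.
Qed.

Theorem mainTheorem6 (d : measure_display) (T : measurableType d)
    (R : realType) (mu : {measure set T -> \bar R})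
    (f0 f1 : T -> R) (eps0 eps1 : R) (c : T -> \bar R) (tl tu : R)
    (hatG0 hatG1 : probability T R) :
  probability_density mu f0 -> probability_density mu f1 ->
  0 < eps0 -> 0 < eps1 ->
  let gU0 := inflate eps0 f0 in
  let gU1 := inflate eps1 f1 in
  upper_band mu gU0 `&` upper_band mu gU1 = set0 ->
  measurable_fun setT c ->
  let l := likelihood_ratio c gU1 gU0 in
  0 < tl -> tl < tu ->
  let hatg0 := lfd0 gU0 gU1 l tl in
  let hatg1 := lfd1 gU0 gU1 l tu in
  (\int[mu]_x (hatg0 x)%:E = 1)%E ->
  (\int[mu]_x (hatg1 x)%:E = 1)%E ->
  has_density mu hatG0 hatg0 -> has_density mu hatG1 hatg1 ->
  single_sample_minimax_robust (upper_band mu gU0) (upper_band mu gU1)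
    hatG0 hatG1 (lfd_ratio gU0 gU1 l tl tu).
Proof.
move=> [mf0 f0_ge0 _] [mf1 f1_ge0 _] eps0_gt0 eps1_gt0 gU0 gU1 _ mc l.
move=> tl_gt0 tltu hatg0 hatg1 _ _ dens0 dens1.
move=> t _ G0 G1 [g0 dg0 g0le] [g1 dg1 g1le].
have gU0_ge0 x : 0 <= gU0 x by rewrite mulr_ge0// addr_ge0// ltW.
have gU1_ge0 x : 0 <= gU1 x by rewrite mulr_ge0// addr_ge0// ltW.
have mgU0 : measurable_fun setT gU0 by exact: measurable_funM.
have mgU1 : measurable_fun setT gU1 by exact: measurable_funM.
under eq_set do rewrite lfd_ratioE//.
(* Outside [(tl, tu]] the event is empty or the whole space, and all probabilities agree on it. *)
have [ttl|tlt] := leP t tl.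
  have -> : [set y | (clip tl tu l y < t%:E)%E] = set0.
    apply/seteqP; split=> // y /=; rewrite ltNge.
    by rewrite (@le_trans _ _ tl%:E)// clip_ge// ltW.
  by rewrite !measure0.
have [ttu|tut] := leP t tu; last first.
  have -> : [set y | (clip tl tu l y < t%:E)%E] = setT.
    apply/seteqP; split=> // y _ /=.
    by rewrite (@le_lt_trans _ _ tu%:E)// clip_le// ltW.
  by rewrite !probability_setT.
under eq_set do rewrite clip_lt//.
have mA : measurable [set y | (l y < t%:E)%E].
  exact: measurable_likelihood_ratio_lt.
split.
  apply: probability_le_setC => //.
  apply: le_has_density dg0 dens0 _ _; first exact: measurableC.
  (* On the complement [tl < t <= l], so [hatg0] equals [gU0], which dominates [g0]. *)
  move=> x /= /negP; rewrite -leNgt => tl_l.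
  by rewrite /hatg0 /lfd0 (le_trans _ tl_l)// lee_fin ltW.
(* On the event [l < t <= tu], so [hatg1] equals [gU1], which dominates [g1]. *)
apply: le_has_density dg1 dens1 mA _ => x /= lt_t.
by rewrite /hatg1 /lfd1 (le_trans (ltW lt_t)).
Qed.
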